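(* Let $S\ge 0$. The first-order fully discrete SAV Fourier-spectral scheme (written out in the context) is unconditionally energy stable in the following sense. For every $\Delta t>0$, whenever real-valued $\phi_N^n,\phi_N^{n+1},\mu_N^{n+1}\in S_N$ and $R^n,R^{n+1}\in\mathbb{R}$ satisfy one step of the scheme, namely $$(\phi_N^{n+1}-\phi_N^n,q)+M\Delta t(\nabla \mu_N^{n+1},\nabla q)=0,\quad \forall q\in S_N,$$ $$(\mu_N^{n+1},\Psi)=\left((\Delta+\beta)\phi_N^{n+1},(\Delta+\beta)\Psi\right)+\lambda(\phi_N^{n+1},\Psi)+S\left(\nabla(\phi_N^{n+1}-\phi_N^n),\nabla\Psi\right)+\frac{R^{n+1}}{\sqrt{E_1(\phi_N^n)}}(F'(\phi_N^n),\Psi),\quad \forall \Psi\in S_N,$$ $$R^{n+1}-R^n=\frac{1}{2\sqrt{E_1(\phi_N^n)}}(F'(\phi_N^n),\phi_N^{n+1}-\phi_N^n),$$ the following discrete energy law holds: $$\mathcal{E}(\phi_N^{n+1},R^{n+1})-\mathcal{E}(\phi_N^n,R^n)+S\|\nabla(\phi_N^{n+1}-\phi_N^n)\|^2\le -M\Delta t\|\nabla\mu_N^{n+1}\|^2 .$$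
   Context: Setting: $\Omega=(0,L_x)\times(0,L_y)$ with periodic boundary conditions; $(\cdot,\cdot)$ and $\|\cdot\|$ are the $L^2(\Omega)$ inner product and norm. The constants satisfy $M>0$ (mobility), $\lambda>0$, $\beta>0$, $0<\epsilon<\beta^2$. The scheme discretizes the phase field crystal equation $\phi_t=M\Delta\mu$, $\mu=(\Delta+\beta)^2\phi+\phi^3-\epsilon\phi$. $F(\phi)=\frac14\phi^4-\frac{\epsilon+\lambda}{2}\phi^2$, so $F'(\phi)=\phi^3-(\epsilon+\lambda)\phi$, and $E_1(\phi)=\int_\Omega F(\phi)\,d\mathbf{x}+C_0$, where the constant $C_0\ge 0$ is chosen such that $E_1(\phi)>0$ for all $\phi$. For a positive even integer $N$, $S_N=\mathrm{span}\{e^{i\xi_k x}e^{i\eta_l y}: -\frac N2\le k\le \frac N2-1,\ -\frac N2\le l\le\frac N2-1\}$ with $\xi_k=2\pi k/L_x$, $\eta_l=2\pi l/L_y$; elements of $S_N$ (unknowns and test functions) are taken real-valued. Discrete energy: $\mathcal{E}(\phi,R)=\frac12\|(\Delta+\beta)\phi\|^2+\frac\lambda2\|\phi\|^2+R^2-C_0$. *)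

(* Defs.v *)
From HB Require Import structures.
From mathcomp Require Import all_boot all_order all_algebra.
From mathcomp Require Export complex.
From mathcomp Require Export all_classical all_reals all_analysis.
From mathcomp Require Import ring lra.

Set Implicit Arguments.
Unset Strict Implicit.
Unset Printing Implicit Defensive.

Import Order.TTheory GRing.Theory Num.Theory.
Import numFieldNormedType.Exports.

Local Open Scope classical_set_scope.
Local Open Scope ring_scope.
Local Open Scope complex_scope.

Section Domain.
Context {R : realType}.

(* Lebesgue measure on the plane, the reals carrying their Borel sigma-algebra. *)
Definition mu2 : {measure set (measurableTypeR R * measurableTypeR R) -> \bar R} :=
  (@lebesgue_measure R \x @lebesgue_measure R)%E.

(* Periodic functions on the torus are represented by functions on the whole
   plane; integrals are taken over one (open) period cell. *)
Definition Omega (Lx Ly : R) : set (R * R) := `]0, Lx[ `*` `]0, Ly[.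

Definition int_Omega (Lx Ly : R) (f : R * R -> R) : R :=
  \int[mu2]_(z in Omega Lx Ly) f z.

Definition inner (Lx Ly : R) (u v : R * R -> R) : R :=
  int_Omega Lx Ly (fun z => u z * v z).

Definition L2norm (Lx Ly : R) (u : R * R -> R) : R :=
  Num.sqrt (inner Lx Ly u u).

Definition vinner (Lx Ly : R) (U V : R * R -> R * R) : R :=
  int_Omega Lx Ly (fun z => (U z).1 * (V z).1 + (U z).2 * (V z).2).

Definition vL2norm (Lx Ly : R) (U : R * R -> R * R) : R :=
  Num.sqrt (vinner Lx Ly U U).

Definition dx (u : R * R -> R) (z : R * R) : R := 'D_((1, 0) : R * R) u z.
Definition dy (u : R * R -> R) (z : R * R) : R := 'D_((0, 1) : R * R) u z.

Definition grad (u : R * R -> R) (z : R * R) : R * R := (dx u z, dy u z).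

Definition laplacian (u : R * R -> R) (z : R * R) : R :=
  dx (dx u) z + dy (dy u) z.

Definition lap_beta (beta : R) (u : R * R -> R) (z : R * R) : R :=
  laplacian u z + beta * u z.

End Domain.

Section FourierSpace.
Context {R : realType}.

(* e^{i t} *)
Definition expi (t : R) : R[i] := cos t +i* sin t.

(* The index j in {0, ..., N-1} stands for the wave number
   k = j - N/2 in {-N/2, ..., N/2 - 1}. *)
Definition wavenumber (N : nat) (L : R) (j : 'I_N) : R :=
  2 * pi * (j%:R - N./2%:R) / L.

Definition SN_complex (Lx Ly : R) (N : nat) : set (R * R -> R[i]) :=
  [set f | exists c : 'I_N -> 'I_N -> R[i], forall z : R * R,
    f z = \sum_(k < N) \sum_(l < N)
      c k l * (expi (wavenumber Lx k * z.1) * expi (wavenumber Ly l * z.2))].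

(* The real-valued elements of S_N. *)
Definition SN (Lx Ly : R) (N : nat) : set (R * R -> R) :=
  [set u | SN_complex Lx Ly N (fun z => (u z)%:C)].

End FourierSpace.

Section Energy.
Context {R : realType}.

Definition Fpot (eps lambda : R) (s : R) : R :=
  4^-1 * s ^+ 4 - (eps + lambda) / 2 * s ^+ 2.

Definition dFpot (eps lambda : R) (s : R) : R := s ^+ 3 - (eps + lambda) * s.

Lemma is_derive_Fpot (eps lambda s : R) :
  is_derive s 1 (Fpot eps lambda) (dFpot eps lambda s).
Proof.
rewrite /Fpot /dFpot; apply: is_derive_eq.
rewrite /GRing.scale /= !mulr1.
by field.
Qed.

Definition E1 (Lx Ly eps lambda C0 : R) (phi : R * R -> R) : R :=
  int_Omega Lx Ly (fun z => Fpot eps lambda (phi z)) + C0.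

(* phi is in the domain of E1, i.e. the integral defining it makes sense and is
   finite; elsewhere the value of int_Omega is a meaningless default. *)
Definition E1_domain (Lx Ly eps lambda : R) : set (R * R -> R) :=
  [set phi | @measurable_fun _ _ (measurableTypeR R * measurableTypeR R)%type R
      (Omega Lx Ly) phi /\
    mu2.-integrable (Omega Lx Ly) (fun z => (Fpot eps lambda (phi z))%:E)].

Definition energy (Lx Ly beta lambda C0 : R) (phi : R * R -> R) (r : R) : R :=
  2^-1 * L2norm Lx Ly (lap_beta beta phi) ^+ 2
  + lambda / 2 * L2norm Lx Ly phi ^+ 2 + r ^+ 2 - C0.

End Energy.

(* Main.v *)
(* Testing the first equation with mu1 and the second with d = phi1 - phi0, and
   replacing the inner product with F' by means of the third equation, gives
     (L phi1, L d) + lambda (phi1, d) + S |grad d|^2 + 2 R1 (R1 - R0)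
       = - M dt |grad mu1|^2,      L = Laplacian + beta.
   By the identity 2 (a, a - b) = |a|^2 - |b|^2 + |a - b|^2 the left-hand side is
   the energy difference plus S |grad d|^2 plus nonnegative squares.

   The identity needs L to be linear on S_N and the products to be integrable.
   Both come from writing elements of S_N as real trigonometric sums with fixed
   frequencies, on which L acts by multiplying the coefficients. *)
Require Import Defs.
From mathcomp Require Import all_boot all_order all_algebra.
From mathcomp Require Import complex.
From mathcomp Require Import all_classical all_reals all_analysis.
From mathcomp Require Import measurable_realfun ring.

Import Order.TTheory GRing.Theory Num.Theory.
Import numFieldNormedType.Exports.

Local Open Scope classical_set_scope.
Local Open Scope ring_scope.

(** The frequencies [a], [b] are kept apart from the amplitudes [A], [B], so that sums with common
    frequencies are handled through their amplitudes alone. *)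
Definition trig_sum {R : realType} {T : finType} (a b A B : T -> R)
    (z : R * R) : R :=
  \sum_t (A t * cos (a t * z.1 + b t * z.2) + B t * sin (a t * z.1 + b t * z.2)).

Section TrigSum.
Context {R : realType} {T : finType}.
Implicit Types (a b A B : T -> R) (z v : R * R).

Lemma trig_sumB a b A B A' B' :
  trig_sum a b A B \- trig_sum a b A' B' = trig_sum a b (A \- A') (B \- B').
Proof.
apply/funext => z; rewrite /trig_sum /= -sumrB.
by apply: eq_bigr => t _ /=; ring.
Qed.

(** Both derivatives are limits of the same difference quotient; this reduces directional
    derivatives to one-variable calculus. *)
Lemma is_derive_line (f : R * R -> R) z v l :
  is_derive (0 : R) 1 (fun h : R => f (h *: v + z)) l -> is_derive z v f l.
Proof.
have E : (fun h : R => h^-1 *: (f (h *: v + z) - f z)) =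
    (fun h : R => h^-1 *: (f ((h *: (1 : R) + 0) *: v + z) - f (0 *: v + z))).
  by apply/funext => h; rewrite [h *: (1 : R)]mulr1 addr0 scale0r add0r.
move=> [df Df]; split.
  by move: df; rewrite /derivable -E.
by move: Df; rewrite /derive -E.
Qed.

Lemma is_derive_sum_seq (I : Type) (s : seq I) (f : I -> R -> R) (df : I -> R) (x : R) :
  (forall i, is_derive x (1 : R) (f i) (df i)) ->
  is_derive x (1 : R) (fun h => \sum_(i <- s) f i h) (\sum_(i <- s) df i).
Proof.
move=> fdf; elim: s => [|i s IH].
  rewrite big_nil; under eq_fun do rewrite big_nil.
  exact: is_derive_cst.
rewrite big_cons; under eq_fun do rewrite big_cons.
exact: is_deriveD.
Qed.

(** Chain rule on the phase: cosine and sine trade places, so the derivative is again a sum with the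
    same frequencies. *)
Lemma is_derive_trig_sum a b A B z v :
  is_derive z v (trig_sum a b A B)
    (trig_sum a b (fun t => (a t * v.1 + b t * v.2) * B t)
                  (fun t => - ((a t * v.1 + b t * v.2) * A t)) z).
Proof.
apply: is_derive_line; apply: is_derive_sum_seq => t.
(* The phase along the line through [z] in direction [v]. *)
pose p (h : R) := a t * (h * v.1 + z.1) + b t * (h * v.2 + z.2).
have dp : is_derive (0 : R) 1 p (a t * v.1 + b t * v.2).
  rewrite /p; apply: is_derive_eq; rewrite /GRing.scale /=; ring.
have p0 : p 0 = a t * z.1 + b t * z.2 by rewrite /p !mul0r !add0r.
have dc := @is_derive1_comp _ cos p 0 _ _ (is_derive_cos _) dp.
have ds := @is_derive1_comp _ sin p 0 _ _ (is_derive_sin _) dp.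
apply: (@is_derive_eq _ _ _ (A t \*: (cos \o p) \+ B t \*: (sin \o p))).
rewrite /GRing.scale /= p0; ring.
Qed.

Lemma dx_trig_sum a b A B :
  dx (trig_sum a b A B) = trig_sum a b (a \* B) (fun t => - (a t * A t)).
Proof.
apply/funext => z; rewrite /dx (@derive_val _ _ _ _ _ _ _ (is_derive_trig_sum a b A B z _)).
by apply: eq_bigr => t _ /=; ring.
Qed.

Lemma dy_trig_sum a b A B :
  dy (trig_sum a b A B) = trig_sum a b (b \* B) (fun t => - (b t * A t)).
Proof.
apply/funext => z; rewrite /dy (@derive_val _ _ _ _ _ _ _ (is_derive_trig_sum a b A B z _)).
by apply: eq_bigr => t _ /=; ring.
Qed.

Lemma lap_beta_trig_sum beta a b A B :
  lap_beta beta (trig_sum a b A B) =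
  trig_sum a b (fun t => (beta - a t ^+ 2 - b t ^+ 2) * A t)
               (fun t => (beta - a t ^+ 2 - b t ^+ 2) * B t).
Proof.
apply/funext => z; rewrite /lap_beta /laplacian !dx_trig_sum !dy_trig_sum.
rewrite /trig_sum mulr_sumr -!big_split.
by apply: eq_bigr => t _ /=; ring.
Qed.

Lemma trig_sum_bound a b A B z :
  `|trig_sum a b A B z| <= \sum_t (`|A t| + `|B t|).
Proof.
apply: le_trans (ler_norm_sum _ _ _) _; apply: ler_sum => t _.
apply: le_trans (ler_normD _ _) _; rewrite !normrM.
by apply: lerD; rewrite ler_piMr // ler_norml ?cos_geN1 ?cos_le1 ?sin_geN1 ?sin_le1.
Qed.

Lemma measurable_trig_sum a b A B :
  @measurable_fun _ _ (measurableTypeR R * measurableTypeR R)%type R setT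
    (trig_sum a b A B).
Proof.
apply: measurable_sum => t.
have mp : @measurable_fun _ _ (measurableTypeR R * measurableTypeR R)%type R
    setT (fun z => a t * z.1 + b t * z.2).
  apply: measurable_funD; apply: measurable_funM; try exact: measurable_cst.
    exact: measurable_fst.
  exact: measurable_snd.
apply: measurable_funD; apply: measurable_funM; try exact: measurable_cst.
  exact: measurableT_comp (continuous_measurable_fun (@continuous_cos R)) mp.
exact: measurableT_comp (continuous_measurable_fun (@continuous_sin R)) mp.
Qed.

End TrigSum.

Section Inner.
Context {R : realType}.
Variables (Lx Ly : R).

Lemma measurable_Omega :
  @measurable _ (measurableTypeR R * measurableTypeR R)%type (Omega Lx Ly).
Proof. by apply: measurableX; exact: measurable_itv. Qed.

Lemma mu2_Omega_fin : (mu2 (Omega Lx Ly) < +oo)%E.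
Proof.
have itv_fin (L : R) : (lebesgue_measure `]0%R, L[%classic < +oo)%E.
  (* The second case is the empty interval, [L <= 0], of measure 0. *)
  by rewrite lebesgue_measure_itv; case: ifP => _; rewrite -?EFinB ltry.
rewrite /mu2 /Omega.
rewrite [ltLHS](@product_measure1E _ _ _ _ _ lebesgue_measure lebesgue_measure);
  [|exact: measurable_itv|exact: measurable_itv].
apply: lte_mul_pinfty; [by []| |exact: itv_fin].
by rewrite ge0_fin_numE //; exact: itv_fin.
Qed.

(** A bounded measurable function on a set of finite measure is integrable. *)
Lemma integrable_trig_sumM (T : finType) (a b A B A' B' : T -> R) :
  mu2.-integrable (Omega Lx Ly)
    (fun z => (trig_sum a b A B z * trig_sum a b A' B' z)%:E).
Proof.
apply: measurable_bounded_integrable.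
- exact: measurable_Omega.
- exact: mu2_Omega_fin.
- apply: (measurable_funS measurableT (@subsetT _ _)).
  by apply: measurable_funM; exact: measurable_trig_sum.
- exists ((\sum_t (`|A t| + `|B t|)) * (\sum_t (`|A' t| + `|B' t|))).
  split; first exact: num_real.
  move=> M leM z _ /=; rewrite normrM.
  by apply: le_trans (ltW leM); apply: ler_pM => //; exact: trig_sum_bound.
Qed.

Lemma innerC (u v : R * R -> R) : inner Lx Ly u v = inner Lx Ly v u.
Proof. by congr int_Omega; apply/funext => z; rewrite mulrC. Qed.

Lemma L2norm_sq (u : R * R -> R) : L2norm Lx Ly u ^+ 2 = inner Lx Ly u u.
Proof. by rewrite sqr_sqrtr //; apply: Rintegral_ge0 => z _; rewrite -expr2 sqr_ge0. Qed.

Lemma vL2norm_sq (U : R * R -> R * R) : vL2norm Lx Ly U ^+ 2 = vinner Lx Ly U U.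
Proof.
by rewrite sqr_sqrtr //; apply: Rintegral_ge0 => z _; rewrite addr_ge0 // -expr2 sqr_ge0.
Qed.

Lemma inner_trig_sumBr (T : finType) (a b A B A' B' A'' B'' : T -> R) :
  inner Lx Ly (trig_sum a b A B) (trig_sum a b A' B' \- trig_sum a b A'' B'') =
  inner Lx Ly (trig_sum a b A B) (trig_sum a b A' B') -
  inner Lx Ly (trig_sum a b A B) (trig_sum a b A'' B'').
Proof.
rewrite /inner /int_Omega.
under [LHS]eq_Rintegral do rewrite mulrBr.
by apply: RintegralB;
  [exact: measurable_Omega|exact: integrable_trig_sumM|exact: integrable_trig_sumM].
Qed.

Lemma trig_sum_polarization (T : finType) (a b A B A' B' : T -> R) :
  let u := trig_sum a b A B in let v := trig_sum a b A' B' in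
  2 * inner Lx Ly u (u \- v) =
  L2norm Lx Ly u ^+ 2 - L2norm Lx Ly v ^+ 2 + L2norm Lx Ly (u \- v) ^+ 2.
Proof.
move=> u v; rewrite !L2norm_sq.
(* As a trigonometric sum, the difference may also stand in the left slot of [inner_trig_sumBr]. *)
have d : u \- v = trig_sum a b (A \- A') (B \- B') by rewrite trig_sumB.
have -> : inner Lx Ly (u \- v) (u \- v) =
    inner Lx Ly u (u \- v) - inner Lx Ly v (u \- v).
  by rewrite {1}d inner_trig_sumBr -!d innerC; congr (_ - _); rewrite innerC.
rewrite !inner_trig_sumBr (innerC v u); ring.
Qed.

Lemma lap_beta_trig_sumB (T : finType) beta (a b A B A' B' : T -> R) :
  lap_beta beta (trig_sum a b A B \- trig_sum a b A' B') =
  lap_beta beta (trig_sum a b A B) \- lap_beta beta (trig_sum a b A' B').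
Proof.
rewrite trig_sumB !lap_beta_trig_sum trig_sumB.
by congr trig_sum; apply/funext => t /=; ring.
Qed.

(** Real parts are taken in the complex expansion. Opposite wave numbers are not paired: for
    positive even [N], -N/2 has no partner in the range. *)
Lemma SN_trig_sum (N : nat) (u : R * R -> R) : SN Lx Ly N u ->
  exists A B : 'I_N * 'I_N -> R,
    u = trig_sum (fun t => wavenumber Lx t.1) (fun t => wavenumber Ly t.2) A B.
Proof.
(* Re((x + iy) e^{is}) = x cos s - y sin s. *)
move=> [c uE]; exists (fun t => complex.Re (c t.1 t.2)), (fun t => - complex.Im (c t.1 t.2)).
apply/funext => z; have /(congr1 (@complex.Re R)) /= -> := uE z.
rewrite pair_big /trig_sum raddf_sum; apply: eq_bigr => -[k l] _ /=.
case: (c k l) => x y /=; rewrite cosD sinD; ring.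
Qed.

(** Makes [phi1 \- phi0] an admissible test function. *)
Lemma SN_sub (N : nat) (u v : R * R -> R) :
  SN Lx Ly N u -> SN Lx Ly N v -> SN Lx Ly N (u \- v).
Proof.
move=> [c uE] [d vE]; exists (fun k l => c k l - d k l) => z /=.
have -> : ((u z - v z)%:C = (u z)%:C - (v z)%:C)%C by rewrite rmorphB.
rewrite uE vE -sumrB; apply: eq_bigr => k _.
by rewrite -sumrB; apply: eq_bigr => l _; rewrite mulrBl.
Qed.

End Inner.

(** The algebra of the energy law, with integrals replaced by numbers. With d = phi1 - phi0, [ip]
    stands for (mu1, d), [lapip] for (L phi1, L d), [phiip] for (phi1, d), [SG] for the
    stabilization term and [D] for the dissipation. *)
Lemma energy_dissipation_from_testing (R : realFieldType)
    (lambda C0 SG D r0 r1 ip lapip phiip lap0 lap1 lapd n0 n1 nd : R) :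
  0 <= lambda -> 0 <= lapd -> 0 <= nd ->
  2 * lapip = lap1 - lap0 + lapd ->
  2 * phiip = n1 - n0 + nd ->
  ip = lapip + lambda * phiip + SG + 2 * r1 * (r1 - r0) ->
  ip + D = 0 ->
  2^-1 * lap1 + lambda / 2 * n1 + r1 ^+ 2 - C0
    - (2^-1 * lap0 + lambda / 2 * n0 + r0 ^+ 2 - C0) + SG <= - D.
Proof.
move=> lambda_ge0 lapd_ge0 nd_ge0 pol_lap pol_phi test_mu test_phi.
(* This is exactly the gap between the two sides of the inequality. *)
have dissip_ge0 : 0 <= 2^-1 * lapd + 2^-1 * (lambda * nd) + (r1 - r0) ^+ 2.
  by rewrite !addr_ge0 ?sqr_ge0 ?mulr_ge0 ?invr_ge0.
have lapdE : lapd = 2 * lapip - lap1 + lap0 by rewrite pol_lap; ring.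
have ndE : nd = 2 * phiip - n1 + n0 by rewrite pol_phi; ring.
have DE : D = - ip by apply/eqP; rewrite -addr_eq0 addrC test_phi.
rewrite DE test_mu -subr_ge0; apply: le_trans dissip_ge0 _.
by rewrite lapdE ndE le_eqVlt; apply/orP; left; apply/eqP; field.
Qed.

Theorem theorem4p1 (R : realType) (Lx Ly M lambda beta eps C0 S dt : R) (N : nat)
    (phi0 phi1 mu1 : R * R -> R) (R0 R1 : R) :
  0 < Lx -> 0 < Ly ->
  0 < M -> 0 < lambda -> 0 < beta -> 0 < eps -> eps < beta ^+ 2 ->
  0 <= C0 ->
  (forall phi : R * R -> R, E1_domain Lx Ly eps lambda phi ->
     0 < E1 Lx Ly eps lambda C0 phi) ->
  (0 < N)%N -> ~~ odd N ->
  0 <= S -> 0 < dt ->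
  SN Lx Ly N phi0 -> SN Lx Ly N phi1 -> SN Lx Ly N mu1 ->
  (forall q : R * R -> R, SN Lx Ly N q ->
     inner Lx Ly (phi1 \- phi0) q
     + M * dt * vinner Lx Ly (grad mu1) (grad q) = 0) ->
  (forall psi : R * R -> R, SN Lx Ly N psi ->
     inner Lx Ly mu1 psi
     = inner Lx Ly (lap_beta beta phi1) (lap_beta beta psi)
       + lambda * inner Lx Ly phi1 psi
       + S * vinner Lx Ly (grad (phi1 \- phi0)) (grad psi)
       + R1 / Num.sqrt (E1 Lx Ly eps lambda C0 phi0)
         * inner Lx Ly (dFpot eps lambda \o phi0) psi) ->
  R1 - R0 = 1 / (2 * Num.sqrt (E1 Lx Ly eps lambda C0 phi0))
            * inner Lx Ly (dFpot eps lambda \o phi0) (phi1 \- phi0) ->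
  energy Lx Ly beta lambda C0 phi1 R1 - energy Lx Ly beta lambda C0 phi0 R0
  + S * vL2norm Lx Ly (grad (phi1 \- phi0)) ^+ 2
  <= - (M * dt * vL2norm Lx Ly (grad mu1) ^+ 2).
Proof.
move=> _ _ _ lambda0 _ _ _ _ _ _ _ _ _ SN0 SN1 SNmu eq_phi eq_mu eq_R.
have := eq_phi _ SNmu; have := eq_mu _ (SN_sub _ _ _ _ _ SN1 SN0).
have [A0 [B0 phi0E]] := SN_trig_sum _ _ _ _ SN0.
have [A1 [B1 phi1E]] := SN_trig_sum _ _ _ _ SN1.
(* Both tested equations now contain the same term (mu1, phi1 - phi0), through which they are
   combined. *)
rewrite (innerC _ _ _ mu1) -!vL2norm_sq.
have := trig_sum_polarization Lx Ly _
  (fun t => wavenumber Lx t.1) (fun t => wavenumber Ly t.2) A1 B1 A0 B0.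
have : 2 * inner Lx Ly (lap_beta beta phi1) (lap_beta beta (phi1 \- phi0)) =
    L2norm Lx Ly (lap_beta beta phi1) ^+ 2 - L2norm Lx Ly (lap_beta beta phi0) ^+ 2
    + L2norm Lx Ly (lap_beta beta (phi1 \- phi0)) ^+ 2.
  (* The images under [lap_beta] keep the frequencies, so polarization applies to them too. *)
  by rewrite phi0E phi1E lap_beta_trig_sumB !lap_beta_trig_sum trig_sum_polarization.
rewrite -phi0E -phi1E => /= pol_lap pol_phi.
(* If the square root is 0, both quotients are 0 and the identity still holds. *)
have -> : R1 / Num.sqrt (E1 Lx Ly eps lambda C0 phi0)
    * inner Lx Ly (dFpot eps lambda \o phi0) (phi1 \- phi0) =
    2 * R1 * (R1 - R0).
  by rewrite eq_R invfM mul1r; move: (Num.sqrt _)^-1 => s; field.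
move=> test_mu test_phi.
exact: energy_dissipation_from_testing (ltW lambda0) (sqr_ge0 _) (sqr_ge0 _)
  pol_lap pol_phi test_mu test_phi.
Qed.
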